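(* Let $p$ be a prime and let $n$ be a positive integer. Let $A\subseteq \mathbb{F}_p^n$ be a set of density $\alpha=|A|/p^n>0$, and let $\varepsilon\in(0,1)$. Then there exists a linear subspace $V\le \mathbb{F}_p^n$ with $$\dim(V)\le \frac{2}{\varepsilon^2}\log\frac{1}{\alpha}$$ such that, for every $\xi\in\mathbb{F}_p^n$ with $\xi\notin V$, $$\mathop{\mathbb E}\limits_{y\in \mathbb F_p^n/V^\perp}\left|\mathop{\mathbb E}\limits_{x\in y+V^\perp}\mathbf{1}_A(x)\,\overline{\chi_\xi(x)}\right|\le \varepsilon\alpha .$$
   Context: For $\xi,x\in\mathbb{F}_p^n$, $\langle \xi,x\rangle=\sum_{i=1}^n \xi_i x_i\in\mathbb{F}_p$, and $\chi_\xi:\mathbb{F}_p^n\to\mathbb{C}$ is the character $\chi_\xi(x)=\omega^{\langle \xi,x\rangle}$ with $\omega=e^{2\pi i/p}$. For a subspace $V\le\mathbb{F}_p^n$, $V^\perp=\{x\in\mathbb{F}_p^n:\langle x,\xi\rangle=0\text{ for every }\xi\in V\}$. Each $y\in\mathbb{F}_p^n/V^\perp$ is identified with the corresponding coset $y+V^\perp$ in $\mathbb{F}_p^n$. $\mathbf{1}_A$ is the indicator function of $A$. $\mathbb{E}_{s\in S}$ denotes the uniform average over a finite non-empty set $S$. $\log$ is the natural logarithm. *)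

(* Defs.v *)
From mathcomp Require Export all_boot all_order all_algebra.
From mathcomp Require Export reals trigo exp.
From mathcomp Require Export complex.

Set Implicit Arguments.
Unset Strict Implicit.
Unset Printing Implicit Defensive.

Import Order.TTheory GRing.Theory Num.Theory.

Local Open Scope ring_scope.
Local Open Scope complex_scope.

Definition avg (K : fieldType) (T : finType) (S : {set T}) (f : T -> K) : K :=
  (\sum_(s in S) f s) / #|S|%:R.

Section Fourier.

Variables (p n : nat).

Local Notation Fpn := 'rV['F_p]_n.

Definition dotp (xi x : Fpn) : 'F_p := \sum_(i < n) xi 0 i * x 0 i.

Definition perp (V : {vspace Fpn}) : {set Fpn} :=
  [set x | [forall xi in V, dotp x xi == 0]].

Definition coset_of_set (W : {set Fpn}) (y : Fpn) : {set Fpn} :=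
  [set y + w | w in W].

(* The quotient F_p^n / W, each of its elements being a coset as a subset of
   F_p^n; distinct representatives of a coset give one element. *)
Definition quot (W : {set Fpn}) : {set {set Fpn}} :=
  [set coset_of_set W y | y : Fpn].

Variable R : realType.

Definition density (A : {set Fpn}) : R := #|A|%:R / p%:R ^+ n.

Definition omega : R[i] :=
  cos (2 * pi / p%:R) +i* sin (2 * pi / p%:R).

(* The exponent is the representative in [0, p) of an element of 'F_p; for p
   prime, omega ^+ p = 1, so that the choice is immaterial. *)
Definition chi (xi x : Fpn) : R[i] := omega ^+ (dotp xi x : nat).

Definition indicator (A : {set Fpn}) (x : Fpn) : R[i] := (x \in A)%:R.

End Fourier.

(* Main.v *)
(** An exponential martingale replaces the entropy increment. If [xi] violates the
    bound for [V], rotate the conjugate of [chi xi] on each coset of [perp V] by a unit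
    phase so that its sum over the points of [A] there is real and nonnegative, and
    let [u] be the real part of the result. Then [|u| <= 1], [u] sums to zero on every
    coset of [perp V], and its mean over [A] exceeds [eps]. By Hoeffding's lemma,
    multiplying by [expR (eps * u - eps ^+ 2 / 2)] a weight that is constant on these
    cosets does not increase its total mass, while the mean over [A] of the logarithm
    of the weight grows by at least [eps ^+ 2 / 2]. Starting from the weight [1] and
    adjoining such [xi] to [V] as long as one exists, Jensen's inequality on [A] gives
    [expR (\dim V * eps ^+ 2 / 2) * #|A| <= p ^ n]. *)

Require Import Defs.
From mathcomp Require Import boolp sequences topology normedtype derive.
From mathcomp Require Import zify ring lra.
Set Implicit Arguments.
Unset Strict Implicit.
Unset Printing Implicit Defensive.
Import Order.TTheory GRing.Theory Num.Theory.
Import numFieldNormedType.Exports.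
Local Open Scope ring_scope.
Local Open Scope complex_scope.

(** * Real inequalities behind Hoeffding's lemma *)

Section Analysis.

Variable R : realType.
Implicit Types (f df : R -> R) (x u l : R).

Lemma le0_is_derive_nincr f df :
    (forall x, is_derive x 1 f (df x)) -> (forall x, 0 <= x -> df x <= 0) ->
  forall x, 0 <= x -> f x <= f 0.
Proof.
move=> fdf df_le0 x x_ge0.
apply: (@ler0_derive1_nincry _ f 0) => //.
- move=> y; rewrite in_itv /= andbT derive1E => /ltW y_ge0.
  by have [_ ->] := fdf y; apply: df_le0.
- apply: continuous_subspaceT => y.
  by apply/differentiable_continuous/derivable1_diffP; have [] := fdf y.
Qed.

(** The left side times [expR (- (x ^+ 2 / 2))] is [h], which equals 2 at 0 and does not increase
    afterwards: its derivative has the sign of [(1 - z) * expR z - (1 + z) * expR (- z)], which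
    vanishes at 0 and has derivative [- z * (expR z - expR (- z)) <= 0]. *)
Lemma cosh_le_expR_sqr x : 0 <= x -> expR x + expR (- x) <= 2 * expR (x ^+ 2 / 2).
Proof.
move=> x_ge0.
have tanh_le (y : R) : 0 <= y -> (1 - y) * expR y <= (1 + y) * expR (- y).
  move=> y_ge0; rewrite -subr_le0.
  pose k z : R := (1 - z) * expR z - (1 + z) * expR (- z).
  pose dk z : R := - z * expR z + z * expR (- z).
  have k0 : k 0 = 0 by rewrite /k oppr0; ring.
  rewrite -[leRHS]k0; apply: (@le0_is_derive_nincr k dk) => // z.
    by apply: is_derive_eq; rewrite /dk /GRing.scale /=; ring.
  move=> z_ge0; rewrite /dk mulNr addrC subr_le0 ler_wpM2l // ler_expR.
  by rewrite ge0_cp.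
pose h z : R := expR (z - z ^+ 2 / 2) + expR (- z - z ^+ 2 / 2).
pose dh z : R := (1 - z) * expR (z - z ^+ 2 / 2) - (1 + z) * expR (- z - z ^+ 2 / 2).
have : h x <= h 0.
  apply: (@le0_is_derive_nincr h dh) => // z.
    by apply: is_derive_eq; rewrite /dh /GRing.scale /=; field.
  by move=> z_ge0; rewrite /dh !expRD !mulrA -mulrBl pmulr_lle0 ?expR_gt0 // subr_le0 tanh_le.
rewrite /h !expRD -mulrDl oppr0 expr0n /= mul0r oppr0 !expR0 mulr1.
by rewrite [expR (- (_ / _))]expRN ler_pdivrMr ?expR_gt0 // -natr1.
Qed.

(** The bound is affine in [u]: summed over a coset where [u] has sum zero, only the hyperbolic
    cosine of [l] survives. *)
Lemma expR_le_chord l u : `|u| <= 1 ->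
  expR (l * u) <= (expR l + expR (- l)) / 2 + u * ((expR l - expR (- l)) / 2).
Proof.
rewrite ler_norml => /andP[u_geN1 u_le1].
(* Average the tangents at [l * u] over the endpoints [l] and [- l]. *)
have tangent (y : R) : expR (l * u) * (1 + (y - l * u)) <= expR y.
  have /(ler_wpM2l (expR_ge0 (l * u))) := expR_ge1Dx (y - l * u).
  by rewrite -expRD [l * u + _]addrC subrK.
have hp := tangent l; have hm := tangent (- l).
(* The weights [(1 + u) / 2] and [(1 - u) / 2] give the endpoints the mean [l * u], so the linear
   terms of the two tangents cancel. *)
have {}hp : (1 + u) / 2 * (expR (l * u) * (1 + (l - l * u))) <= (1 + u) / 2 * expR l.
  by rewrite ler_wpM2l //; lra.
have {}hm : (1 - u) / 2 * (expR (l * u) * (1 + (- l - l * u))) <= (1 - u) / 2 * expR (- l).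
  by rewrite ler_wpM2l //; lra.
have := lerD hp hm; congr (_ <= _); by field.
Qed.

End Analysis.

(** * Modulus and phase of complex numbers *)

Lemma normc_Re (R : realType) (z : R[i]) : `|complex.Re z| <= ComplexField.Normc.normc z.
Proof.
case: z => a b /=; rewrite -sqrtr_sqr ler_wsqrtr // lerDl; exact: sqr_ge0.
Qed.

Lemma Re_sum (R : realType) (I : finType) (P : pred I) (F : I -> R[i]) :
  complex.Re (\sum_(i | P i) F i) = \sum_(i | P i) complex.Re (F i).
Proof. by apply: (big_morph (@complex.Re R)) => // -[a b] [c d]. Qed.

Lemma normcJ (R : realType) (z : R[i]) :
  ComplexField.Normc.normc z^*%C = ComplexField.Normc.normc z.
Proof. by case: z => a b /=; rewrite sqrrN. Qed.

Lemma normc_divn (R : realType) (z : R[i]) (k : nat) :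
  ComplexField.Normc.normc (z / k%:R) = ComplexField.Normc.normc z / k%:R.
Proof.
have normc_nat : ComplexField.Normc.normc (k%:R : R[i]) = k%:R.
  have -> : (k%:R : R[i]) = k%:R +i* 0 by rewrite -[LHS](rmorph_nat (real_complex R)).
  by rewrite /= expr0n addr0 sqrtr_sqr ger0_norm.
by rewrite ComplexField.Normc.normcM ComplexField.Normc.normcV normc_nat.
Qed.

(** The phase is the conjugate of [z] over its modulus; the bound [<= 1] also admits [c = 0], taken
    when [z = 0]. *)
Lemma exists_phase (R : realType) (z : R[i]) :
  exists2 c : R[i], ComplexField.Normc.normc c <= 1
    & complex.Re (c * z) = ComplexField.Normc.normc z.
Proof.
have [->|z_neq0] := eqVneq z 0.
  by exists 0; rewrite ?mulr0 ComplexField.Normc.normc0 // ler01.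
have nz_neq0 : ComplexField.Normc.normc z != 0.
  by apply: contraNneq z_neq0 => /ComplexField.Normc.eq0_normc ->.
exists ((ComplexField.Normc.normc z)^-1%:C * z^*%C).
  rewrite ComplexField.Normc.normcM normcJ /= expr0n addr0 sqrtr_sqr.
  by rewrite ger0_norm ?invr_ge0 ?sqrtr_ge0 ?mulVf //; case: (z) => a b /=; rewrite sqrtr_ge0.
move: nz_neq0; case: (z) => a b /= nz_neq0; rewrite !mul0r !subr0.
have : Num.sqrt (a ^+ 2 + b ^+ 2) ^+ 2 = a ^+ 2 + b ^+ 2.
  by rewrite sqr_sqrtr // addr_ge0 ?sqr_ge0.
move: nz_neq0; set r := Num.sqrt _ => r_neq0 r2.
by apply: (mulfI r_neq0); rewrite -expr2 r2; field.
Qed.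

(** * Additive characters *)

Section Characters.

Variables (R : realType) (p n : nat).
Hypothesis p_prime : prime p.

Local Notation Fpn := 'rV['F_p]_n.
Implicit Types (x y h xi : Fpn) (V W : {vspace Fpn}).

Lemma omega_expn k :
  omega p R ^+ k = cos (2 * pi / p%:R * k%:R) +i* sin (2 * pi / p%:R * k%:R).
Proof.
elim: k => [|k IHk]; first by rewrite mulr0 cos0 sin0.
rewrite exprSr IHk -[k.+1%:R]natr1 [_ * (k%:R + 1)]mulrDr mulr1 cosD sinD.
by apply/eqP; rewrite eq_complex /= eqxx /= addrC.
Qed.

Lemma omega_expp : omega p R ^+ p = 1.
Proof.
have p_neq0 : p%:R != 0 :> R by rewrite pnatr_eq0 -lt0n prime_gt0.
by rewrite omega_expn divfK // mulr_natl cos2pi sin2pi.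
Qed.

Lemma omega_expn_neq1 k : (0 < k < p)%N -> omega p R ^+ k != 1.
Proof.
move=> /andP[k_gt0 k_ltp]; rewrite omega_expn.
have p_gt0 : 0 < p%:R :> R by rewrite ltr0n prime_gt0.
(* Half of the angle: [t] lies strictly between 0 and [pi], so [sin t > 0] and the cosine of
   [t *+ 2] is not 1. *)
pose t : R := pi * (k%:R / p%:R).
have -> : 2 * pi / p%:R * k%:R = t *+ 2 :> R by rewrite /t -mulr_natl; ring.
have sint_gt0 : 0 < sin t.
  apply: sin_gt0_pi; rewrite mulr_gt0 ?pi_gt0 ?divr_gt0 ?ltr0n //= ?prime_gt0 //.
  by rewrite gtr_pMr ?pi_gt0 // ltr_pdivrMr // mul1r ltr_nat.
apply/eqP => -[+ _]; rewrite cos_mulr2n => cos2t.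
have /eqP : sin t ^+ 2 = 0 by rewrite sin2cos2; lra.
by rewrite sqrf_eq0 gt_eqF.
Qed.

Lemma dotpDr xi x y : dotp xi (x + y) = dotp xi x + dotp xi y.
Proof. by rewrite -big_split /=; apply: eq_bigr => i _; rewrite mxE mulrDr. Qed.

Lemma dotpC x y : dotp x y = dotp y x.
Proof. by apply: eq_bigr => i _; rewrite mulrC. Qed.

Lemma dotpNr xi x : dotp xi (- x) = - dotp xi x.
Proof. by rewrite -sumrN; apply: eq_bigr => i _; rewrite mxE mulrN. Qed.

Lemma chiD xi x y : chi R xi (x + y) = chi R xi x * chi R xi y.
Proof.
rewrite /chi dotpDr -exprD /= -[in RHS](expr_mod _ omega_expp).
(* Addition in ['F_p] reduces modulo [(Zp_trunc (pdiv p)).+2], which is [p] because [p] is prime. *)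
by congr (_ ^+ (_ %% _)); apply: Fp_cast.
Qed.

Lemma normc_chi xi x : ComplexField.Normc.normc (chi R xi x) = 1.
Proof. by rewrite /chi omega_expn /= cos2Dsin2 sqrtr1. Qed.

Lemma chi_eq1 xi x : (chi R xi x == 1) = (dotp xi x == 0).
Proof.
have [d0|d_neq0] := eqVneq (dotp xi x) 0; first by rewrite /chi d0 expr0 eqxx.
apply/negbTE/omega_expn_neq1; rewrite lt0n -val_eqE in d_neq0 *.
by rewrite d_neq0 /=; apply: leq_trans (ltn_ord _) _; rewrite Fp_cast.
Qed.

(** * Annihilators and their cosets *)

Lemma mem_perp V x : reflect (forall xi, xi \in V -> dotp x xi = 0) (x \in perp V).
Proof.
rewrite inE; apply: (iffP forallP) => Vx xi; first by move=> Vxi; apply/eqP/(implyP (Vx xi)).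
by apply/implyP => /Vx /eqP.
Qed.

Lemma perpD V x y : x \in perp V -> y \in perp V -> x + y \in perp V.
Proof.
move=> /mem_perp Vx /mem_perp Vy; apply/mem_perp => xi Vxi.
by rewrite dotpC dotpDr !(dotpC xi) Vx ?Vy ?addr0.
Qed.

Lemma perpN V x : x \in perp V -> - x \in perp V.
Proof.
by move=> /mem_perp Vx; apply/mem_perp => xi Vxi; rewrite dotpC dotpNr dotpC Vx ?oppr0.
Qed.

Lemma perp0 V : 0 \in perp V.
Proof. by apply/mem_perp => xi _; apply: big1 => i _; rewrite mxE mul0r. Qed.

Lemma perpS V W : (V <= W)%VS -> perp W \subset perp V.
Proof.
move=> /subvP VW; apply/subsetP => x /mem_perp Wx.
by apply/mem_perp => xi /VW; apply: Wx.
Qed.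

(** The nontrivial half of the double annihilator identity. With a basis of [V] as the rows of [M],
    the columns of [cokermx M] lie in [perp V] and together detect membership in [V]. *)
Lemma notin_perp_perp V xi :
  xi \notin V -> exists2 h, h \in perp V & dotp xi h != 0.
Proof.
move=> xi_V; pose M : 'M_(\dim V, n) := \matrix_(i, j) (vbasis V)`_i 0 j.
have rowM i : row i M = (vbasis V)`_i by apply/rowP => j; rewrite !mxE.
have memM (v : Fpn) : (v <= M)%MS = (v \in V).
  apply/submxP/idP => [[u ->]|Vv].
    rewrite mulmx_sum_row memv_suml // => i _; rewrite memvZ // rowM.
    by rewrite vbasis_mem // mem_nth // size_tuple.
  exists (\row_i coord (vbasis V) i v).
  rewrite {1}(coord_vbasis Vv) mulmx_sum_row; apply: eq_bigr => i _.
  by rewrite rowM mxE.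
have dotpE v j : (v *m cokermx M) 0 j = dotp v (row j (cokermx M)^T).
  by rewrite mxE; apply: eq_bigr => i _; rewrite !mxE.
have : xi *m cokermx M != 0 by rewrite -memM submxE in xi_V.
case/rV0Pn => j; rewrite dotpE => xi_j; exists (row j (cokermx M)^T) => //.
apply/mem_perp => v; rewrite -memM submxE => /eqP vM.
by rewrite dotpC -dotpE vM mxE.
Qed.

Lemma mem_coset V x y : (x \in coset_of_set (perp V) y) = (x - y \in perp V).
Proof.
apply/imsetP/idP => [[w Vw ->]|Vxy]; first by rewrite addrC addKr.
by exists (x - y); rewrite // addrC subrK.
Qed.

Lemma coset_eq V x y :
  (coset_of_set (perp V) x == coset_of_set (perp V) y)
  = (x \in coset_of_set (perp V) y).
Proof.
rewrite mem_coset; apply/eqP/idP => [Exy|Vxy].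
  by rewrite -mem_coset -Exy mem_coset subrr perp0.
apply/setP => z; rewrite !mem_coset; apply/idP/idP => Vz.
  by rewrite -(subrK x z) -addrA perpD.
by rewrite -(subrK y z) -addrA perpD // -opprB perpN.
Qed.

Lemma card_coset V y : #|coset_of_set (perp V) y| = #|perp V|.
Proof. exact/card_imset/addrI. Qed.

Lemma sum_quot (M : nmodType) V (F : Fpn -> M) :
  \sum_x F x = \sum_(C in quot (perp V)) \sum_(x in C) F x.
Proof.
rewrite (partition_big (coset_of_set (perp V)) [in quot (perp V)]) /=; last first.
  by move=> x _; apply: imset_f.
apply: eq_bigr => _ /imsetP[y _ ->]; apply: eq_bigl => x; exact: coset_eq.
Qed.

Lemma card_quot V : (#|quot (perp V)| * #|perp V| = p ^ n)%N.
Proof.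
have <- : #|{: Fpn}| = (p ^ n)%N by rewrite card_mx mul1n card_Fp.
transitivity (\sum_(x : Fpn) 1)%N; last by rewrite sum1_card.
rewrite (sum_quot V) -sum_nat_const; apply: eq_bigr => _ /imsetP[y _ ->].
by rewrite sum1_card card_coset.
Qed.

(** Translation by some [h] in [perp V] with [chi xi h != 1] permutes the coset and multiplies the
    sum by [chi xi h], so the sum vanishes. *)
Lemma sum_chi_coset V xi C :
  xi \notin V -> C \in quot (perp V) -> \sum_(x in C) chi R xi x = 0.
Proof.
move=> /notin_perp_perp[h Vh xih] /imsetP[y _ ->].
set D := coset_of_set _ y.
have D_shift x : (h + x \in D) = (x \in D).
  by rewrite !mem_coset -addrA; apply/idP/idP => [/(perpD (perpN Vh))|/(perpD Vh)//]; rewrite addKr.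
have /eqP : \sum_(x in D) chi R xi x = chi R xi h * \sum_(x in D) chi R xi x.
  rewrite {1}(reindex_inj (addrI h)) mulr_sumr.
  by apply: eq_big => x; rewrite ?D_shift ?chiD.
rewrite -subr_eq0 -{1}[\sum_(_ in _) _]mul1r -mulrBl mulf_eq0.
by rewrite subr_eq0 eq_sym chi_eq1 (negPf xih) => /eqP.
Qed.

(** * The increment and its exponential sum *)

Lemma avg_quot V (f : Fpn -> R[i]) :
  avg (quot (perp V)) (fun C : {set Fpn} => ComplexField.Normc.normc (avg C f))
  = (\sum_(C in quot (perp V)) ComplexField.Normc.normc (\sum_(x in C) f x)) / p%:R ^+ n.
Proof.
rewrite /avg -natrX -(card_quot V) natrM [_%:R * _]mulrC [in RHS]invfM mulrA [in RHS]mulr_suml.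
congr (_ / _); apply: eq_bigr => _ /imsetP[y _ ->].
by rewrite normc_divn card_coset.
Qed.

(* [u x] is the real part of the conjugate character at [x], rotated on each coset of
   [perp V] by the phase making the sum over [A] there real and nonnegative. *)
Lemma exists_increment V xi (A : {set Fpn}) : xi \notin V ->
  exists u : Fpn -> R,
    [/\ forall x h, h \in perp (V + <[xi]>)%VS -> u (x + h) = u x,
        forall x, `|u x| <= 1,
        forall C, C \in quot (perp V) -> \sum_(x in C) u x = 0
      & \sum_(x in A) u x = \sum_(C in quot (perp V))
          ComplexField.Normc.normc (\sum_(x in C) indicator R A x * (chi R xi x)^*)].
Proof.
move=> xi_V.
pose S (C : {set Fpn}) := \sum_(x in C) indicator R A x * (chi R xi x)^*.
have [c c_le1 cS] : exists2 c : {set Fpn} -> R[i],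
    forall C, ComplexField.Normc.normc (c C) <= 1
  & forall C, complex.Re (c C * S C) = ComplexField.Normc.normc (S C).
  have /choice[c cP] : forall C, exists z : R[i], ComplexField.Normc.normc z <= 1
      /\ complex.Re (z * S C) = ComplexField.Normc.normc (S C).
    by move=> C; have [z] := exists_phase (S C); exists z.
  by exists c => C; have [] := cP C.
pose u x := complex.Re (c (coset_of_set (perp V) x) * (chi R xi x)^*).
have uE C x : C \in quot (perp V) -> x \in C -> u x = complex.Re (c C * (chi R xi x)^*).
  by case/imsetP => y _ ->; rewrite /u -coset_eq => /eqP ->.
exists u; split.
(* A shift by [h] stays in the same coset of [perp V], hence keeps the phase, and [chi xi h = 1]
   since [h] also annihilates [xi]. *)
- move=> x h Wh; rewrite /u chiD.
  have -> : coset_of_set (perp V) (x + h) = coset_of_set (perp V) x.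
    apply/eqP; rewrite coset_eq mem_coset addrAC subrr add0r.
    exact: subsetP (perpS (addvSl V <[xi]>)) _ Wh.
  have /eqP -> : chi R xi h == 1.
    rewrite chi_eq1 dotpC; apply/eqP/(mem_perp _ _ Wh).
    exact: subvP (addvSr V <[xi]>) _ (memv_line xi).
  by rewrite mulr1.
- move=> x; apply: le_trans (normc_Re _) _.
  by rewrite ComplexField.Normc.normcM normcJ normc_chi mulr1.
- move=> C QC; rewrite (eq_bigr _ (fun x => uE C x QC)) -Re_sum -mulr_sumr.
  by rewrite -rmorph_sum (sum_chi_coset xi_V QC) rmorph0 mulr0.
rewrite big_mkcond (sum_quot V); apply: eq_bigr => C QC.
rewrite -[RHS]cS mulr_sumr Re_sum; apply: eq_bigr => x Cx.
by rewrite (uE C) // /indicator; case: ifP => _; rewrite ?mul1r // mul0r mulr0.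
Qed.

(** On each coset [g] is constant, the chord bound loses its linear term because [u] sums to zero,
    and the remaining hyperbolic cosine of [l] is at most [expR (l ^+ 2 / 2)]. *)
Lemma sum_expR_increment V (g u : Fpn -> R) (l : R) : 0 <= l ->
    (forall x h, h \in perp V -> g (x + h) = g x) -> (forall x, `|u x| <= 1) ->
    (forall C, C \in quot (perp V) -> \sum_(x in C) u x = 0) ->
  \sum_x expR (g x + (l * u x - l ^+ 2 / 2)) <= \sum_x expR (g x).
Proof.
move=> l_ge0 gV u_le1 u_sum0; rewrite !(sum_quot V) ler_sum // => C QC.
have [y _ EC] := imsetP QC.
have gC x : x \in C -> g x = g y.
  by rewrite EC mem_coset => /(gV y) <-; rewrite addrC subrK.
rewrite [leRHS](eq_bigr (fun=> expR (g y))); last by move=> x /gC ->.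
pose a := (expR l + expR (- l)) / 2; pose b := (expR l - expR (- l)) / 2.
pose k := expR (g y - l ^+ 2 / 2).
apply: (@le_trans _ _ (\sum_(x in C) k * (a + u x * b))).
  apply: ler_sum => x /gC ->.
  by rewrite addrCA addrC expRD ler_wpM2l ?expR_ge0 // expR_le_chord.
rewrite -mulr_sumr big_split /= -[X in _ * (_ + X)]mulr_suml u_sum0 // mul0r addr0 mulr_sumr.
apply: ler_sum => x _; rewrite /k expRD expRN -mulrA ler_piMr ?expR_ge0 //.
rewrite mulrC ler_pdivrMr ?expR_gt0 // mul1r ler_pdivrMr // mulrC.
exact: cosh_le_expR_sqr.
Qed.

End Characters.

(** * Iterated increments and the dimension bound *)

Theorem theorem1p3 (R : realType) (p n : nat) (A : {set 'rV['F_p]_n}) (eps : R)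
    (p_prime : prime p) (n_gt0 : (0 < n)%N)
    (A_dense : 0 < density R A) (eps01 : 0 < eps < 1) :
  exists V : {vspace 'rV['F_p]_n},
    (\dim V)%:R <= 2 / eps ^+ 2 * ln (1 / density R A) /\
    forall xi : 'rV['F_p]_n, xi \notin V ->
      avg (quot (perp V)) (fun y : {set 'rV['F_p]_n} =>
        ComplexField.Normc.normc
          (avg y (fun x => indicator R A x * (chi R xi x)^*%C)))
      <= eps * density R A.
Proof.
have /andP[eps_gt0 _] := eps01.
have pn_gt0 : 0 < p%:R ^+ n :> R by rewrite exprn_gt0 // ltr0n prime_gt0.
have A_gt0 : 0 < #|A|%:R :> R by move: A_dense; rewrite /density pmulr_lgt0 // invr_gt0.
pose bias V xi := avg (quot (perp V)) (fun y : {set 'rV['F_p]_n} =>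
  ComplexField.Normc.normc (avg y (fun x => indicator R A x * (chi R xi x)^*%C))).
pose m (V : {vspace 'rV['F_p]_n}) : R := (\dim V)%:R * (eps ^+ 2 / 2).
(* [g] is the logarithm of the exponential martingale built along the chain of
   subspaces leading to [V]; [m V] bounds its mean over [A] from below. *)
pose good (V : {vspace 'rV['F_p]_n}) := exists g : 'rV['F_p]_n -> R,
  [/\ forall x h, h \in perp V -> g (x + h) = g x,
      \sum_x expR (g x) <= p%:R ^+ n & m V * #|A|%:R <= \sum_(x in A) g x].
have good_dim V : good V -> (\dim V)%:R <= 2 / eps ^+ 2 * ln (1 / density R A).
  case=> g [_ g_exp g_A].
  have : expR (m V) * #|A|%:R <= p%:R ^+ n.
    apply: le_trans g_exp.
    apply: (@le_trans _ _ (\sum_(x in A) expR (m V) * (1 + (g x - m V)))).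
      rewrite -mulr_sumr ler_wpM2l ?expR_ge0 // big_split sumrB /= !sumr_const.
      by rewrite lerDl subr_ge0 -mulr_natr.
    (* Tangent of [expR] at [m V], in place of Jensen's inequality. *)
    rewrite [leRHS](bigID [in A]) /= -[leLHS]addr0 lerD //; last first.
      by apply: sumr_ge0 => x _; apply: expR_ge0.
    apply: ler_sum => x _.
    have /(ler_wpM2l (expR_ge0 (m V))) := expR_ge1Dx (g x - m V).
    by rewrite -expRD [m V + _]addrC subrK.
  rewrite -ler_pdivlMr // => m_le.
  have : m V <= ln (1 / density R A).
    rewrite -ler_expR lnK ?posrE ?divr_gt0 //.
    by rewrite /density div1r invf_div.
  rewrite /m mulrA ler_pdivrMr // -ler_pdivlMr ?exprn_gt0 // => /le_trans-> //.
  by rewrite le_eqVlt; apply/orP; left; apply/eqP; ring.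
(* Induction on a bound [k] for the codimension: adjoining a violating [xi] lowers it, and at 0 no
   [xi] is left outside [V]. *)
suff step k V : (n - \dim V <= k)%N -> good V -> exists2 W, good W
    & forall xi, xi \notin W -> bias W xi <= eps * density R A.
  have [|W W_good W_xi] := step n 0%VS (leq_subr _ _).
    exists (fun=> 0); split=> //.
      by rewrite expR0 sumr_const card_mx card_Fp // mul1n natrX.
    by rewrite /m dimv0 !mul0r big1.
  by exists W; split; [exact: good_dim | exact: W_xi].
elim: k V => [|k IHk] V dimV V_good.
  exists V => // xi; suff -> : V = fullv by rewrite memvf.
  apply/eqP; rewrite eqEdim subvf /=.
  by rewrite dimvf /dim /= mul1n -subn_eq0 -leqn0.
have [V_xi|] := pselect (forall xi, xi \notin V -> bias V xi <= eps * density R A);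
  first by exists V.
move=> /existsNP[xi /not_implyP[xi_V /negP]]; rewrite -ltNge => xi_large.
have [u [u_inv u_le1 u_sum0 u_A]] := exists_increment R p_prime A xi_V.
have [g [g_inv g_exp g_A]] := V_good.
have dimW : \dim (V + <[xi]>)%VS = (\dim V).+1.
  apply/eqP; rewrite eqn_leq; apply/andP; split.
    have [+ _] := dimv_add_leqif V <[xi]>%VS; move=> /leq_trans-> //.
    by rewrite dim_vline -[leqRHS]addn1 leq_add2l leq_b1.
  rewrite ltn_neqAle; have [-> ->] := dimv_leqif_sup (addvSl V <[xi]>%VS).
  rewrite andbT; apply: contra xi_V => /subvP; apply.
  exact: subvP (addvSr V <[xi]>) _ (memv_line xi).
apply: (IHk (V + <[xi]>)%VS); first by rewrite dimW subnS -ltnS; lia.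
(* The step size [l = eps] maximises the guaranteed gain [l * eps - l ^+ 2 / 2] per point of [A];
   its value [eps ^+ 2 / 2] is the growth of [m] for one more dimension. *)
exists (fun x => g x + (eps * u x - eps ^+ 2 / 2)); split.
- move=> x h Wh; rewrite u_inv // g_inv //.
  exact: subsetP (perpS (addvSl V <[xi]>)) _ Wh.
- by apply: le_trans g_exp; apply: sum_expR_increment u_sum0 => //; apply: ltW.
rewrite !big_split /= sumrN sumr_const -mulr_sumr.
have u_large : eps * #|A|%:R < \sum_(x in A) u x.
  by rewrite u_A; move: xi_large; rewrite /bias avg_quot // /density mulrA ltr_pM2r // invr_gt0.
have := ltW u_large; rewrite -(ler_pM2l eps_gt0) => {}u_large.
rewrite /m dimW -natr1 mulrDl mulrDl lerD // mul1r -mulr_natr.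
by rewrite lerBrDr; apply: le_trans u_large; rewrite le_eqVlt; apply/orP; left; apply/eqP; field.
Qed.
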